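(* Let $X\in\mathbb{R}^{m\times n}$ with $\operatorname{rank}(X)=r\le d$. Let $0<p\le 1$, $p_1>0$ and $p_2>0$ satisfy $1/p_1+1/p_2=1/p$. Then the minimum below is attained and \[ \|X\|_{S_p}=\min_{U\in\mathbb{R}^{m\times d},\,V\in\mathbb{R}^{n\times d}:\,X=UV^{T}}\|U\|_{S_{p_1}}\|V\|_{S_{p_2}}. \]
   Context: For $0<q<\infty$ and a real matrix $Y$ with singular values $\sigma_1(Y),\dots,\sigma_k(Y)$ ($k$ the smaller dimension of $Y$), the Schatten-$q$ (quasi-)norm is $\|Y\|_{S_q}=\left(\sum_{i=1}^{k}\sigma_i(Y)^q\right)^{1/q}$. *)

(* Defs.v *)
From HB Require Import structures.
From mathcomp Require Import all_boot all_order all_algebra.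
From mathcomp Require Import all_classical all_reals all_analysis.
Set Implicit Arguments. Unset Strict Implicit. Unset Printing Implicit Defensive.
Import Order.TTheory GRing.Theory Num.Theory.
Local Open Scope classical_set_scope.
Local Open Scope ring_scope.

(* The squared singular values of X : 'M_(m,n) are the eigenvalues (with
   algebraic multiplicity) of the positive semidefinite matrix X^T X.
   Eigenvalues equal to 0 contribute 0 to sigma^q for q > 0, so summing over
   all eigenvalues of X^T X (counted with multiplicity) gives exactly
   sum_{i=1}^{min(m,n)} sigma_i(X)^q.                                      *)
Definition gram_charpoly (R : realType) (m n : nat) (X : 'M[R]_(m, n)) : {poly R} :=
  char_poly (X^T *m X).

Definition schatten_sum (R : realType) (q : R) (m n : nat) (X : 'M[R]_(m, n)) : R :=
  let P := gram_charpoly X in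
  (\sum_(l \in [set l : R | root P l]) (mup l P)%:R * (l `^ (q / 2)))%R.

Definition schatten (R : realType) (q : R) (m n : nat) (X : 'M[R]_(m, n)) : R :=
  (schatten_sum q X) `^ (q^-1).

(* Main.v *)
(* Every positive semidefinite Gram matrix is diagonalized as O^T D O with O
   orthogonal and D nonincreasing.  Since AB and BA have the same characteristic
   polynomial up to a power of X, the nonzero spectrum of X^T X for X = U V^T is
   that of H (V^T V) H with H = (U^T U)^(1/2).  Compressing this matrix to its
   top j eigenvectors and using det (C^T N C) <= (l_1 ... l_j) det (C^T C) for N
   with eigenvalues l_1 >= l_2 >= ... (Cauchy-Binet) yields Horn's inequalities
   prod_(i <= j) s_i(X) <= prod_(i <= j) s_i(U) s_i(V).  Weak log-majorization
   (AM-GM and Abel summation) turns them into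
   sum s_i(X)^p <= sum s_i(U)^p s_i(V)^p, and Hoelder's inequality concludes.
   Equality holds when the singular values s_i of X are distributed as
   s_i^(p/p1) in U and s_i^(p/p2) in V along a singular value decomposition. *)
Require Import Defs.
From HB Require Import structures.
From mathcomp Require Import all_boot all_order all_algebra all_fingroup.
From mathcomp Require Import all_classical all_reals all_analysis.
From mathcomp Require Import complex ring lra.
Set Implicit Arguments.
Unset Strict Implicit.
Unset Printing Implicit Defensive.
Import Order.TTheory GRing.Theory Num.Theory.
Local Open Scope ring_scope.

(** * Determinants and characteristic polynomials *)

(** Both sides come from the block matrix [M]: a block-triangular factor on its right or on its left
    clears the lower left block. Nothing is inverted, so [x] may be the indeterminate. *)
Lemma det_scalar_sub_mulC (R : comPzRingType) (m n : nat) (x : R)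
    (A : 'M[R]_(m, n)) (B : 'M[R]_(n, m)) :
  x ^+ n * \det (x%:M - A *m B) = x ^+ m * \det (x%:M - B *m A).
Proof.
pose M := block_mx (x%:M : 'M[R]_m) A B (1%:M : 'M[R]_n).
have detl : \det (x%:M - A *m B) = \det M.
  have : \det (M *m block_mx 1%:M 0 (- B) 1%:M) = \det M.
    by rewrite det_mulmx det_lblock !det1 !mulr1.
  rewrite mulmx_block !mulmx1 !mulmx0 !mul1mx mulmxN subrr !add0r.
  by rewrite det_ublock det1 mulr1.
have : \det (block_mx 1%:M 0 (- B) (x%:M : 'M[R]_n) *m M) = x ^+ n * \det M.
  by rewrite det_mulmx det_lblock det1 mul1r det_scalar.
rewrite mulmx_block !mul1mx !mul0mx !addr0 mulmx1.
rewrite mulNmx -scalar_mxC addNr det_ublock det_scalar.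
by rewrite detl mulNmx [- _ + _]addrC => <-.
Qed.

Lemma char_poly_mulC (R : comNzRingType) (m n : nat)
    (A : 'M[R]_(m, n)) (B : 'M[R]_(n, m)) :
  'X^n * char_poly (A *m B) = 'X^m * char_poly (B *m A).
Proof.
by rewrite /char_poly /char_poly_mx !map_mxM det_scalar_sub_mulC.
Qed.

(** Multilinearity in the rows: row [i] of [A *m B] is a combination of rows of [B], and [f i]
    records the row picked. *)
Lemma det_mulmx_rect (R : comNzRingType) (k d : nat)
    (A : 'M[R]_(k, d)) (B : 'M[R]_(d, k)) :
  \det (A *m B) =
    \sum_(f : {ffun 'I_k -> 'I_d}) (\prod_i A i (f i)) * \det (rowsub f B).
Proof.
rewrite /determinant.
under eq_bigr => s _.
  under eq_bigr => i _ do rewrite mxE.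
  rewrite bigA_distr_bigA mulr_sumr /=; over.
rewrite exchange_big; apply: eq_bigr => f _; rewrite mulr_sumr.
apply: eq_bigr => s _; rewrite mulrCA; congr (_ * _).
by rewrite big_split; congr (_ * _); apply: eq_bigr => i _; rewrite mxE.
Qed.

(* Cauchy-Binet, summed over all maps [f] instead of increasing ones: the
   non-injective [f] contribute 0 and each k-subset is counted k! times. *)
Lemma det_gram_diag (R : comNzRingType) (k d : nat) (v : 'rV[R]_d)
    (C : 'M[R]_(d, k)) :
  \det (C^T *m diag_mx v *m C) *+ k`! =
    \sum_(f : {ffun 'I_k -> 'I_d}) (\prod_i v 0 (f i)) * \det (rowsub f C) ^+ 2.
Proof.
rewrite det_mulmx_rect.
transitivity (\sum_(s : 'S_k) \sum_(f : {ffun 'I_k -> 'I_d})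
   (\prod_i v 0 (f i)) * ((-1) ^+ s * (\prod_i rowsub f C (s i) i)) 
     * \det (rowsub f C)).
  (* One copy is spent on each permutation [s], with [f] reindexed by [s]; the signed products then
     sum to a second determinant. *)
  rewrite -{1}(card_Sn k) -sumr_const.
  apply: eq_big => [s|s _]; first by rewrite inE.
  pose h (t : 'S_k) (f : {ffun 'I_k -> 'I_d}) := [ffun i => f (t i)].
  have h_inj : injective (h s).
    apply: (@can_inj _ _ _ (h s^-1%g)) => f; apply/ffunP => i.
    by rewrite !ffunE permKV.
  rewrite (reindex_inj h_inj); apply: eq_bigr => f _.
  have -> : rowsub (h s f) C = row_perm s (rowsub f C).
    by apply/matrixP => i j; rewrite !mxE ffunE.
  rewrite row_permE det_mulmx det_perm.
  have -> : \prod_i (C^T *m diag_mx v) i (h s f i) =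
      (\prod_i v 0 (f i)) * \prod_i rowsub f C (s i) i.
    rewrite [X in _ = X * _](reindex_perm s) -big_split /=; apply: eq_bigr => i _.
    by rewrite ffunE mul_mx_diag !mxE mulrC.
  by rewrite mulrACA !mulrA.
rewrite exchange_big; apply: eq_bigr => f _.
rewrite -mulr_suml -mulr_sumr expr2 mulrA; congr (_ * _ * _).
rewrite -[in RHS]det_tr; apply: eq_bigr => s _; congr (_ * _).
by apply: eq_bigr => i _; rewrite !mxE.
Qed.

(** The entry at position [r] of a strictly increasing list bounded below by [m] is at least
    [m + r]; the offset [m] carries the induction. *)
Lemma prod_sorted_le (R : realDomainType) (v : nat -> R) (m : nat) (s : seq nat) :
  (forall i, 0 <= v i) -> {homo v : i j / (i <= j)%N >-> j <= i} ->
  all (leq m) s -> sorted ltn s ->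
  \prod_(j <- s) v j <= \prod_(i < size s) v (m + i)%N.
Proof.
move=> v0 vh; elim: s m => [|x s IHs] m; first by rewrite big_nil big_ord0.
move=> /= /andP[mx _] xs; rewrite big_cons big_ord_recl addn0.
apply: ler_pM; rewrite ?prodr_ge0 ?vh //.
under [leRHS]eq_bigr => i _ do rewrite lift0 addnS -addSn.
apply: IHs; last exact: path_sorted xs.
apply/allP => y /(allP (order_path_min ltn_trans xs)) /=.
exact: leq_ltn_trans.
Qed.

Lemma prod_uniq_le (R : realDomainType) (v : nat -> R) (s : seq nat) :
  (forall i, 0 <= v i) -> {homo v : i j / (i <= j)%N >-> j <= i} ->
  uniq s -> \prod_(j <- s) v j <= \prod_(i < size s) v i.
Proof.
move=> v0 vh us; have ps := permEl (perm_sort leq s).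
rewrite -(perm_big _ ps) -(perm_size ps) /=.
apply: (prod_sorted_le (m := 0)) => //; first by apply/allP.
by rewrite ltn_sorted_uniq_leq sort_uniq us sort_sorted //; exact: leq_total.
Qed.

Notation diag_seq n x := (diag_mx (\row_(i < n) x (nat_of_ord i))).

(** Termwise comparison of the Cauchy-Binet sums for [v] and for the constant 1: an injective [f]
    picks [k] distinct values of [v], and any other [f] repeats a row, so its minor is 0. *)
Lemma det_compress_le (R : realDomainType) (k d : nat) (v : nat -> R)
    (C : 'M[R]_(d, k)) :
  (forall i, 0 <= v i) -> {homo v : i j / (i <= j)%N >-> j <= i} ->
  \det (C^T *m diag_seq d v *m C) <= (\prod_(i < k) v i) * \det (C^T *m C).
Proof.
move=> v0 vh; rewrite -(ler_pMn2r (fact_gt0 k)) -mulrnAr.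
rewrite -[in leRHS](mulmx1 C^T) -diag_const_mx !det_gram_diag mulr_sumr.
apply: ler_sum => /= f _.
have -> : \prod_(i < k) (const_mx 1 : 'rV[R]_d) 0 (f i) = 1.
  by rewrite big1 // => i _; rewrite mxE.
rewrite mul1r.
have [/injectiveP finj|/injectivePn[i [j ij fij]]] := boolP (injectiveb f).
  apply: ler_wpM2r; first exact: sqr_ge0.
  under eq_bigr => i _ do rewrite mxE.
  have := @prod_uniq_le _ v [seq val (f i) | i : 'I_k] v0 vh.
  rewrite size_map size_enum_ord big_map big_enum /=; apply.
  by rewrite map_inj_uniq ?enum_uniq // => i j /val_inj /finj.
rewrite (determinant_alternate ij) ?expr0n ?mulr0 // => l.
by rewrite !mxE fij.
Qed.

(** * The real spectral theorem *)

(** For a complex eigenvector [v] of eigenvalue [z], the number [v A v^*] equals [z |v|^2] and is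
    its own conjugate, so [z] is real. *)
Lemma sym_eigenvalue (R : rcfType) (n : nat) (A : 'M[R]_n.+1) :
  A^T = A -> exists a, eigenvalue A a.
Proof.
move=> symA; pose AC := map_mx (real_complex R) A.
have [z /eigenvalueP[v vA v0]] := @eigenvalue_closed _ _ AC (ltn0Sn _).
pose w := map_mx Num.conj v^T.
have ACh : map_mx Num.conj AC^T = AC.
  apply/matrixP => i j; rewrite !mxE -[in RHS]symA mxE.
  by apply/CrealP/complex_realP; exists (A j i).
have vw : v *m w = (\sum_i `|v 0 i| ^+ 2)%:M.
  rewrite [LHS]mx11_scalar mxE; congr (_%:M); apply: eq_bigr => i _.
  by rewrite !mxE normCK.
have vwN0 : \sum_i `|v 0 i| ^+ 2 != 0.
  apply: contra v0; rewrite psumr_eq0 => [/allP sv|i _]; last exact: exprn_ge0.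
  apply/eqP/rowP => i; rewrite mxE; apply/eqP.
  by have /= := sv i (mem_index_enum i); rewrite sqrf_eq0 normr_eq0.
have vAw : v *m AC *m w = (z * \sum_i `|v 0 i| ^+ 2)%:M.
  by rewrite vA -scalemxAl vw scale_scalar_mx.
have : map_mx Num.conj (v *m AC *m w)^T = v *m AC *m w.
  have wv : map_mx Num.conj w^T = v.
    by apply/matrixP => i j; rewrite !mxE conjCK.
  by rewrite !trmx_mul !map_mxM ACh mulmxA wv.
rewrite vAw => /matrixP /(_ 0 0); rewrite !mxE /= mulr1n rmorphM /=.
have -> : (\sum_i `|v 0 i| ^+ 2)^* = \sum_i `|v 0 i| ^+ 2.
  by apply/CrealP/ger0_real; rewrite sumr_ge0 // => i _; rewrite exprn_ge0.
move=> /(mulIf vwN0) /CrealP /complex_realP[a za]; exists a.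
(* The eigenvector found is complex; it is the root of the characteristic polynomial that descends
   to [R]. *)
rewrite eigenvalue_root_char -(fmorph_root (real_complex R)) map_char_poly.
by rewrite -eigenvalue_root_char /= -[real_complex R a]za; apply/eigenvalueP; exists v.
Qed.

(** Deflation tool: conjugation by the symmetric involution [H] moves a unit eigenvector [u] to the
    first basis vector. *)
Lemma orthogonal_first_row (R : rcfType) (n : nat) (u : 'rV[R]_n.+1) :
  u *m u^T = 1%:M -> exists2 H : 'M[R]_n.+1, H^T = H /\ H *m H = 1%:M &
    row 0 H = u.
Proof.
move=> u1; pose e : 'rV[R]_n.+1 := delta_mx 0 0.
have [->|ue] := eqVneq u e.
  exists 1%:M; last by rewrite row1.
  by rewrite trmx1 mulmx1.
pose w := u - e; pose c := (w *m w^T) 0 0.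
have wwE : w *m w^T = c%:M by rewrite -mx11_scalar.
have e1 : e *m e^T = 1%:M.
  by rewrite trmx_delta mul_delta_mx; apply/matrixP => i j; rewrite !mxE !ord1.
have c_gt0 : c != 0.
  apply: contra ue; rewrite /c mxE psumr_eq0 => [/allP sw|i _]; last first.
    by rewrite [w^T _ _]mxE -expr2 sqr_ge0.
  rewrite -subr_eq0; apply/eqP/rowP => i; apply/eqP.
  have := sw i (mem_index_enum i).
  by rewrite /= [w^T _ _]mxE -expr2 sqrf_eq0 [X in _ -> _ == X]mxE.
(* The Householder reflection exchanging [e] and [u]. *)
exists (1%:M - (2 / c) *: (w^T *m w)).
  split; first by rewrite linearB linearZ /= trmx1 trmx_mul trmxK.
  set P := w^T *m w; have PP : P *m P = c *: P.
    by rewrite mulmxA -(mulmxA w^T) wwE mul_mx_scalar -scalemxAl.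
  rewrite mulmxBl mul1mx mulmxBr mulmx1 -scalemxAl -scalemxAr PP !scalerA.
  have -> : 2 / c * (2 / c) * c = 2 / c + 2 / c by field.
  by rewrite scalerDl opprB addrK subrK.
(* Expanding [|e + w|^2 = |u|^2 = 1] gives [2 e.w + c = 0]; hence the reflection sends [e] to
   [e + w = u]. *)
have ew : e *m w^T = - (c / 2)%:M.
  have weE : w *m e^T = e *m w^T.
    rewrite -[LHS]trmxK trmx_mul trmxK; apply/matrixP => i j.
    by rewrite !ord1 mxE.
  have : (e + w) *m (e + w)^T = 1%:M by rewrite addrC subrK.
  rewrite linearD /= mulmxDl !mulmxDr e1 wwE weE [e *m w^T]mx11_scalar.
  move/matrixP => /(_ 0 0); rewrite -!raddfD /= -raddfN !mxE !mulr1n => tc.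
  congr (_%:M); lra.
rewrite rowE mulmxBr mulmx1 -scalemxAr mulmxA ew mulNmx.
rewrite mul_scalar_mx scalerN opprK scalerA mulrA mulfVK // divff ?pnatr_eq0 //.
by rewrite scale1r addrC subrK.
Qed.

(** Induction on the size: after conjugation by a reflection built on a unit eigenvector, symmetry
    splits off a 1 by 1 block. The rows of [O] are the eigenvectors. *)
Lemma sym_spectral (R : rcfType) (n : nat) (A : 'M[R]_n) : A^T = A ->
  exists (O : 'M[R]_n) (v : 'rV[R]_n),
    O *m O^T = 1%:M /\ A = O^T *m diag_mx v *m O.
Proof.
elim: n A => [|n IHn] A symA.
  by exists 1%:M, 0; split; [rewrite trmx1 mulmx1 | rewrite !flatmx0].
have [a /eigenvalueP[v vA v0]] := sym_eigenvalue symA.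
pose c := (v *m v^T) 0 0; pose u := (Num.sqrt c)^-1 *: v.
have c_gt0 : 0 < c.
  rewrite lt_def; apply/andP; split; last first.
    by rewrite /c mxE sumr_ge0 // => i _; rewrite [v^T _ _]mxE -expr2 sqr_ge0.
  apply: contra v0; rewrite /c mxE psumr_eq0 => [/allP sv|i _]; last first.
    by rewrite [v^T _ _]mxE -expr2 sqr_ge0.
  apply/eqP/rowP => i; apply/eqP; have := sv i (mem_index_enum i).
  by rewrite /= [v^T _ _]mxE -expr2 sqrf_eq0 [X in _ -> _ == X]mxE.
have uA : u *m A = a *: u by rewrite -scalemxAl vA !scalerA mulrC.
have u1 : u *m u^T = 1%:M.
  rewrite linearZ /= -scalemxAl -scalemxAr scalerA [v *m _]mx11_scalar -/c.
  rewrite scale_scalar_mx -invfM -expr2 sqr_sqrtr ?ltW // mulVf //.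
  by rewrite gt_eqF.
have [H [HT HH] H0] := orthogonal_first_row u1.
pose M : 'M[R]_(1 + n) := H *m A *m H.
have MT : M^T = M by rewrite !trmx_mul HT symA mulmxA.
have M0 : row 0 M = a *: delta_mx 0 0.
  by rewrite /M !row_mul H0 uA -scalemxAl -H0 -row_mul HH row1.
have Mur : ursubmx M = 0.
  apply/matrixP => i j; have /rowP/(_ (rshift 1 j)) := M0.
  by rewrite !mxE ord1 lshift0 => ->; rewrite mulr0.
have Mul : ulsubmx M = a%:M.
  apply/matrixP => i j; have /rowP/(_ 0) := M0.
  by rewrite !mxE !ord1 lshift0 eqxx mulr1n => ->; rewrite mulr1.
have Mdl : dlsubmx M = 0 by rewrite -MT -trmx_ursub Mur trmx0.
have [|P [w [PP EP]]] := IHn (drsubmx M).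
  by rewrite trmx_drsub MT.
have EM : M = block_mx a%:M 0 0 (drsubmx M) by rewrite -[LHS]submxK Mur Mul Mdl.
pose K : 'M[R]_(1 + n) := block_mx 1%:M 0 0 P.
have KT : K^T = block_mx 1%:M 0 0 P^T by rewrite tr_block_mx trmx1 !trmx0.
have KK : K *m K^T = 1%:M.
  rewrite KT mulmx_block PP !mul0mx !mulmx0 mul1mx !addr0 add0r.
  by rewrite -scalar_mx_block.
have KDK : K^T *m diag_mx (row_mx a%:M w) *m K = M.
  rewrite KT diag_mx_row !mulmx_block [RHS]EM EP !mul0mx !mulmx0 !mulmx1.
  rewrite !mul1mx !addr0 !add0r !mul0mx; congr block_mx.
  by apply/matrixP => i j; rewrite !mxE !ord1 !eqxx !mulr1n.
exists (K *m H), (row_mx a%:M w); split.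
  by rewrite trmx_mul HT -mulmxA (mulmxA H) HH mul1mx KK.
have -> : A = H *m M *m H.
  by rewrite /M !mulmxA HH mul1mx -mulmxA HH mulmx1.
by rewrite -KDK trmx_mul HT !mulmxA.
Qed.

(** Each eigenvalue is the squared norm of a column of [B *m O^T], hence nonnegative. Sorting
    permutes the rows of [O], and padding with 0 keeps [x] nonincreasing on all of [nat]. *)
Lemma gram_spectral (R : rcfType) (m n : nat) (B : 'M[R]_(m, n)) :
  exists (O : 'M[R]_n) (x : nat -> R),
    [/\ O *m O^T = 1%:M, B^T *m B = O^T *m diag_seq n x *m O,
        forall i, 0 <= x i, {homo x : i j / (i <= j)%N >-> j <= i}
      & forall i, (n <= i)%N -> x i = 0].
Proof.
have [|O [v [OO EB]]] := @sym_spectral R n (B^T *m B).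
  by rewrite trmx_mul trmxK.
have v0 i : 0 <= v 0 i.
  have : (O *m (B^T *m B) *m O^T) i i = v 0 i.
    rewrite EB !mulmxA OO mul1mx -mulmxA OO mulmx1.
    by rewrite mxE eqxx mulr1n.
  move=> <-; rewrite mulmxA -mulmxA -[X in X *m _]trmxK trmx_mul trmxK mxE.
  by apply: sumr_ge0 => j _; rewrite [_^T _ _]mxE -expr2 sqr_ge0.
pose t := [tuple v 0 i | i < n]; pose s := sort_tuple >=%R t.
have ss : sorted >=%R s by apply: sort_sorted; move=> a b; exact: le_total.
have [p sp] : exists p : 'S_n, s = [tuple tnth t (p i) | i < n] :> seq R.
  by apply/tuple_permP; exact: permEl (perm_sort _ _).
pose x := nth 0 s.
have xE (i : 'I_n) : x i = v 0 (p i).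
  by rewrite /x sp (nth_map i) ?size_enum_ord // nth_ord_enum tnth_mktuple.
have x0 i : (n <= i)%N -> x i = 0 by move=> ni; rewrite /x nth_default ?size_tuple.
have x_ge0 i : 0 <= x i.
  by case: (ltnP i n) => [lin|/x0 -> //]; rewrite (xE (Ordinal lin)).
exists (row_perm p O), x; split => //.
- rewrite row_permE trmx_mul mulmxA -(mulmxA _ O) OO mulmx1.
  by rewrite tr_perm_mx -perm_mxM mulgV perm_mx1.
- rewrite EB; apply/matrixP => i j; rewrite !mul_mx_diag !mxE.
  rewrite (reindex_perm p) /=; apply: eq_bigr => k _.
  by rewrite !mxE xE.
move=> i j ij; case: (ltnP j n) => [jn|/x0 -> //].
apply: (sorted_leq_nth _ _ 0 ss) => //.
- by move=> b a c ab bc; exact: le_trans bc ab.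
- by move=> a; exact: lexx.
- by rewrite inE size_tuple (leq_ltn_trans ij).
- by rewrite inE size_tuple.
Qed.

(** * Majorization and Hoelder's inequality *)

(** Summation by parts in inductive form: lowering the weight cannot increase its product with a
    nonnegative partial sum. *)
Lemma abel_sum_ge (R : realDomainType) (w d : nat -> R) (k : nat) :
  {homo w : i j / (i <= j)%N >-> j <= i} ->
  (forall j, (j <= k)%N -> 0 <= \sum_(i < j) d i) ->
  w k * (\sum_(i < k) d i) <= \sum_(i < k) w i * d i.
Proof.
move=> wh; elim: k => [|k IHk] d0; first by rewrite !big_ord0 mulr0.
apply: (le_trans (ler_wpM2r (d0 _ (leqnn _)) (wh _ _ (leqnSn k)))).
rewrite !big_ord_recr /= mulrDr lerD2r.
by apply: IHk => j jk; rewrite d0 // leqW.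
Qed.

Lemma ln_prod (R : realType) (I : Type) (s : seq I) (t : I -> R) :
  (forall i, 0 < t i) -> ln (\prod_(i <- s) t i) = \sum_(i <- s) ln (t i).
Proof.
move=> t0; elim: s => [|i s IHs]; first by rewrite !big_nil ln1.
by rewrite !big_cons lnM ?IHs // ?posrE ?prodr_gt0.
Qed.

(** Sum the inequality [ln t <= t - 1]. *)
Lemma sum_ge_prod_ge1 (R : realType) (j : nat) (t : 'I_j -> R) :
  (forall i, 0 < t i) -> 1 <= \prod_i t i -> 0 <= \sum_i (t i - 1).
Proof.
move=> t0 /ln_ge0; rewrite ln_prod // => /le_trans; apply.
apply: ler_sum => i _.
have := @le_ln1Dx R (t i - 1); rewrite [1 + _]addrC subrK; apply.
by rewrite ltrBrDr addNr.
Qed.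

(** The ratios [y i / x i] have partial products at least 1, so their excesses over 1 have
    nonnegative partial sums; Abel summation with the weights [x i] turns these into the claim. *)
Lemma sum_le_of_prod_le (R : realType) (x y : nat -> R) (k : nat) :
  (forall i, 0 <= x i) -> {homo x : i j / (i <= j)%N >-> j <= i} ->
  (forall i, 0 <= y i) ->
  (forall j, (j <= k)%N -> \prod_(i < j) x i <= \prod_(i < j) y i) ->
  \sum_(i < k) x i <= \sum_(i < k) y i.
Proof.
move=> x0 xh y0; elim: k => [|k IHk] xy; first by rewrite !big_ord0.
have [xk|xk] := eqVneq (x k) 0.
  rewrite !big_ord_recr /= xk addr0 ler_wpDr //.
  by apply: IHk => j jk; rewrite xy // leqW.
have xi0 (i : nat) : (i <= k)%N -> 0 < x i.
  by move=> ik; apply: lt_le_trans (xh _ _ ik); rewrite lt_def xk x0.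
have yi0 (i : nat) : (i <= k)%N -> 0 < y i.
  move=> ik; rewrite lt_def y0 andbT.
  have : 0 < \prod_(i < k.+1) y i.
    by apply: lt_le_trans (xy _ (leqnn _)); apply: prodr_gt0 => l _; rewrite xi0 -1?ltnS.
  move/lt0r_neq0/prodf_neq0/(_ (Ordinal (ik : (i < k.+1)%N))).
  by apply.
have : 0 <= \sum_(i < k.+1) x i * (y i / x i - 1).
  pose d i := y i / x i - 1.
  have d0 j : (j <= k.+1)%N -> 0 <= \sum_(i < j) d i.
    move=> jk; have ik (i : 'I_j) : (i <= k)%N by rewrite -ltnS (leq_trans _ jk).
    apply: (sum_ge_prod_ge1 (t := fun i : 'I_j => y i / x i)) => [i|].
      by rewrite divr_gt0 ?xi0 ?yi0.
    rewrite prodf_div ler_pdivlMr ?mul1r ?xy //.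
    by apply: prodr_gt0 => i _; rewrite xi0.
  by apply: le_trans (abel_sum_ge xh d0); rewrite mulr_ge0 ?d0.
under eq_bigr => i _ do rewrite mulrBr mulr1 mulrCA divff ?mulr1 ?gt_eqF ?xi0 -1?ltnS //.
by rewrite big_split /= sumrN subr_ge0.
Qed.

(** Once both sums are scaled to 1, Young's inequality [a^s b^t <= s a + t b] applies term by term.
    A zero sum cannot be scaled and is treated apart. *)
Lemma holder_sum (R : realType) (I : finType) (a b : I -> R) (s t : R) :
  (forall i, 0 <= a i) -> (forall i, 0 <= b i) ->
  0 < s -> 0 < t -> s + t = 1 ->
  \sum_i a i `^ s * b i `^ t <= (\sum_i a i) `^ s * (\sum_i b i) `^ t.
Proof.
move=> a0 b0 s0 t0 st.
set SA := \sum_i a i; set SB := \sum_i b i.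
have SA0 : 0 <= SA by exact: sumr_ge0.
have SB0 : 0 <= SB by exact: sumr_ge0.
have sum0 (c : I -> R) i : (forall i, 0 <= c i) -> \sum_i c i = 0 -> c i = 0.
  move=> c0 /eqP; rewrite psumr_eq0 // => /allP/(_ i (mem_index_enum i)).
  by move=> /eqP.
have [SAz|SAn] := eqVneq SA 0.
  rewrite big1 ?mulr_ge0 ?powR_ge0 // => i _.
  by rewrite (sum0 _ _ a0 SAz) powR0 ?mul0r // gt_eqF.
have [SBz|SBn] := eqVneq SB 0.
  rewrite big1 ?mulr_ge0 ?powR_ge0 // => i _.
  by rewrite (sum0 _ _ b0 SBz) powR0 ?mulr0 // gt_eqF.
have SAp : 0 < SA by rewrite lt_def SAn.
have SBp : 0 < SB by rewrite lt_def SBn.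
have -> : \sum_i a i `^ s * b i `^ t =
    \sum_i ((a i / SA) `^ s * (b i / SB) `^ t) * (SA `^ s * SB `^ t).
  apply: eq_bigr => i _; rewrite mulrACA -!powRM ?divr_ge0 //.
  by rewrite !divfK.
rewrite -mulr_suml -[leRHS]mul1r ler_wpM2r ?mulr_ge0 ?powR_ge0 //.
have -> : 1 = \sum_i (s * (a i / SA) + t * (b i / SB)).
  by rewrite big_split /= -!mulr_sumr -!mulr_suml -/SA -/SB !divff // !mulr1.
apply: ler_sum => i _.
have := @conjugate_powR R ((a i / SA) `^ s) ((b i / SB) `^ t) s^-1 t^-1.
rewrite !invrK -!powRrM !divff ?gt_eqF // !powRr1 ?divr_ge0 //.
by rewrite (mulrC s) (mulrC t); apply; rewrite ?powR_ge0 ?invr_gt0.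
Qed.

(** * Schatten quasi-norms *)

(** Powers of ['X] change only the multiplicity of the root 0, whose contribution [0 ^ (q / 2)] is
    0. Spectra of matrices of different sizes thus become comparable. *)
Lemma schatten_sumE (R : realType) (q : R) (m n N a b : nat) (X : 'M[R]_(m, n))
    (x : nat -> R) : 0 < q ->
  'X^a * char_poly (X^T *m X) = 'X^b * \prod_(i < N) ('X - (x i)%:P) ->
  schatten_sum q X = \sum_(i < N) x i `^ (q / 2).
Proof.
move=> q0 Ex; rewrite /schatten_sum /gram_charpoly.
set P := char_poly _ in Ex *; pose s := [seq x i | i : 'I_N].
have P0 : P != 0 by rewrite monic_neq0 ?char_poly_monic.
have mupP l : l != 0 -> mup l P = count_mem l s.
  move=> l0; have rX k : ~~ root ('X^k : {poly R}) l.
    by rewrite /root hornerXn expf_neq0.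
  rewrite -(mupMr _ (rX a)) Ex mupMr // -mu_prod_XsubC.
  by rewrite big_map big_enum.
have f0 : (0 : R) `^ (q / 2) = 0 by rewrite powR0 // gt_eqF // divr_gt0.
pose G l := (mup l P)%:R * l `^ (q / 2).
have GE l : G l = (count_mem l s)%:R * l `^ (q / 2).
  by have [->|/mupP lP] := eqVneq l 0; rewrite /G ?f0 ?mulr0 ?lP.
rewrite (fsbig_widen _ setT G) //; last first.
  by move=> l [_ /= /negP]; rewrite /G => /mupNroot ->; rewrite mul0r.
rewrite -(fsbig_widen [set` undup s] setT G) //; last first.
  move=> l [_ /= /negP]; rewrite mem_undup GE => ls.
  by rewrite (count_memPn ls) mul0r.
rewrite -fsbig_seq ?undup_uniq //.
transitivity (\sum_(l <- s) l `^ (q / 2)).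
  rewrite -[RHS]big_undup_iterop_count; apply: eq_bigr => l _.
  by rewrite GE mulr_natl.
by rewrite big_map big_enum.
Qed.

Lemma char_poly_spectral (R : idomainType) (n : nat) (O : 'M[R]_n)
    (x : nat -> R) : O *m O^T = 1%:M ->
  char_poly (O^T *m diag_seq n x *m O) = \prod_(i < n) ('X - (x i)%:P).
Proof.
move=> OO; have Xn0 : 'X^n != 0 :> {poly R} by rewrite monic_neq0 ?monicXn.
apply: (mulfI Xn0); rewrite char_poly_mulC mulmxA OO mul1mx; congr (_ * _).
rewrite char_poly_trig ?diag_mx_is_trig //.
by apply: eq_bigr => i _; rewrite !mxE eqxx mulr1n.
Qed.

(** * Horn's inequalities and the lower bound for products of factors *)

Lemma compress_diag (R : comNzRingType) (j n : nat) (jn : (j <= n)%N)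
    (O : 'M[R]_n) (x : nat -> R) : O *m O^T = 1%:M ->
  (colsub (widen_ord jn) O^T)^T *m (O^T *m diag_seq n x *m O)
    *m colsub (widen_ord jn) O^T = diag_seq j x.
Proof.
move=> OO; set w := widen_ord jn.
have -> : (colsub w O^T)^T = rowsub w O by apply/matrixP => a b; rewrite !mxE.
rewrite mul_rowsub_mx mulmx_colsub mul_rowsub_mx !mulmxA OO mul1mx.
rewrite -mulmxA OO mulmx1.
by apply/matrixP => a b; rewrite !mxE.
Qed.

Lemma det_spectral_compress_le (R : realDomainType) (k d : nat) (O : 'M[R]_d)
    (v : nat -> R) (C : 'M[R]_(d, k)) :
  O *m O^T = 1%:M ->
  (forall i, 0 <= v i) -> {homo v : i j / (i <= j)%N >-> j <= i} ->
  \det (C^T *m (O^T *m diag_seq d v *m O) *m C)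
    <= (\prod_(i < k) v i) * \det (C^T *m C).
Proof.
move=> /mulmx1C OO v0 vh; have := det_compress_le (O *m C) v0 vh.
by rewrite trmx_mul !mulmxA -(mulmxA C^T O^T O) OO mulmx1.
Qed.

(** The sequences hold squared singular values. [x] is read off a [d] by [d] matrix while [X^T X] is
    [n] by [n], whence the powers of ['X]. *)
Lemma horn_prod_le (R : rcfType) (m n d : nat) (U : 'M[R]_(m, d))
    (V : 'M[R]_(n, d)) (X := U *m V^T) :
  exists x u v : nat -> R,
  [/\ [/\ forall i, 0 <= x i, forall i, 0 <= u i & forall i, 0 <= v i],
      {homo x : i j / (i <= j)%N >-> j <= i},
      'X^d * char_poly (X^T *m X) = 'X^n * \prod_(i < d) ('X - (x i)%:P),
      char_poly (U^T *m U) = \prod_(i < d) ('X - (u i)%:P) /\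
      char_poly (V^T *m V) = \prod_(i < d) ('X - (v i)%:P)
    & forall j, (j <= d)%N -> \prod_(i < j) x i <= \prod_(i < j) (u i * v i)].
Proof.
have [OU [u [OU1 EU u0 uh _]]] := gram_spectral U.
have [OV [v [OV1 EV v0 vh _]]] := gram_spectral V.
pose H := OU^T *m diag_seq d (fun i => Num.sqrt (u i)) *m OU.
have HT : H^T = H by rewrite !trmx_mul trmxK tr_diag_mx mulmxA.
have HH : H *m H = U^T *m U.
  rewrite EU /H !mulmxA -(mulmxA _ OU) OU1 mulmx1 -(mulmxA OU^T) mulmx_diag.
  congr (_ *m diag_mx _ *m _).
  by apply/rowP => i; rewrite !mxE -expr2 sqr_sqrtr.
(* Since [X^T X = (V H) (V H)^T], its nonzero spectrum is that of the Gram matrix of [V H]. *)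
clearbody H; have [OX [x [OX1 EX x0 xh _]]] := gram_spectral (V *m H).
exists x, u, v; split => //.
- rewrite -(char_poly_spectral x OX1) -EX -(char_poly_mulC (V *m H)).
  congr (_ * char_poly _); rewrite /X !trmx_mul trmxK HT.
  by rewrite !mulmxA -(mulmxA V H) HH !mulmxA.
- by rewrite EU EV !char_poly_spectral.
move=> j jd; set Q := colsub (widen_ord jd) OX^T.
have QQ : Q^T *m Q = 1%:M.
  have := compress_diag jd (fun=> 1) OX1; rewrite -/Q.
  have -> : diag_seq d (fun=> 1) = 1%:M :> 'M[R]_d.
    by apply/matrixP => a b; rewrite !mxE.
  rewrite mulmx1 (mulmx1C OX1) mulmx1 => ->.
  by apply/matrixP => a b; rewrite !mxE.
have -> : \prod_(i < j) x i = \det ((H *m Q)^T *m (V^T *m V) *m (H *m Q)).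
  transitivity (\det (diag_seq j x)).
    by rewrite det_diag; apply: eq_bigr => i _; rewrite mxE.
  rewrite -(compress_diag jd x OX1) -/Q -EX.
  by rewrite !trmx_mul HT !mulmxA.
(* Two compressions: the first, with [C = H Q], extracts the [v i] and leaves [Q^T U^T U Q]; the
   second, with [C = Q], extracts the [u i] and leaves [det (Q^T Q) = 1]. *)
rewrite EV (le_trans (det_spectral_compress_le _ OV1 v0 vh)) //.
rewrite big_split /= mulrC ler_wpM2r ?prodr_ge0 //.
rewrite trmx_mul HT mulmxA -(mulmxA Q^T) HH EU.
by rewrite (le_trans (det_spectral_compress_le _ OU1 u0 uh)) // QQ det1 mulr1.
Qed.

Lemma powR_prod (R : realType) (j : nat) (x : 'I_j -> R) (s : R) :
  (forall i, 0 <= x i) -> (\prod_i x i) `^ s = \prod_i x i `^ s.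
Proof.
move=> x0; suff [] : 0 <= \prod_i x i /\ (\prod_i x i) `^ s = \prod_i x i `^ s by [].
elim/big_ind2: _ => [|a b c e [a0 <-] [c0 <-]|i _]; first by rewrite powR1.
  by rewrite mulr_ge0 ?powRM.
by [].
Qed.

Lemma schatten_mul_le (R : realType) (m n d : nat) (U : 'M[R]_(m, d))
    (V : 'M[R]_(n, d)) (p p1 p2 : R) :
  0 < p -> 0 < p1 -> 0 < p2 -> p1^-1 + p2^-1 = p^-1 ->
  schatten p (U *m V^T) <= schatten p1 U * schatten p2 V.
Proof.
move=> p0 p10 p20 pp.
have [x [u [v [[x0 u0 v0] xh EX [EU EV] xuv]]]] := horn_prod_le U V.
rewrite /schatten (schatten_sumE p0 EX).
rewrite (@schatten_sumE _ p1 _ _ d 0 0 U u) ?EU //.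
rewrite (@schatten_sumE _ p2 _ _ d 0 0 V v) ?EV //.
(* The right side is shaped for Hoelder with weights [p / p1] and [p / p2]. It regroups into powers
   [p / 2] of [u i * v i], halved because the values are squared singular values. *)
have sum_le : \sum_(i < d) x i `^ (p / 2) <=
    \sum_(i < d) (u i `^ (p1 / 2)) `^ (p / p1) * (v i `^ (p2 / 2)) `^ (p / p2).
  have -> : \sum_(i < d) (u i `^ (p1 / 2)) `^ (p / p1) *
     (v i `^ (p2 / 2)) `^ (p / p2) = \sum_(i < d) (u i * v i) `^ (p / 2).
    apply: eq_bigr => i _; rewrite powRM // -!powRrM.
    by congr (_ `^ _ * _ `^ _); field; rewrite ?gt_eqF.
  have s0 : 0 <= p / 2 by rewrite divr_ge0 ?ltW.
  apply: (sum_le_of_prod_le (x := fun i => x i `^ (p / 2))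
            (y := fun i => (u i * v i) `^ (p / 2))) => [i|i j ij|i|j jd].
  - exact: powR_ge0.
  - by rewrite ge0_ler_powR ?nnegrE ?xh.
  - exact: powR_ge0.
  rewrite -!powR_prod; try by move=> i; rewrite ?mulr_ge0.
  by rewrite ge0_ler_powR ?nnegrE ?prodr_ge0 ?xuv // => i _; rewrite mulr_ge0.
have ab : p / p1 + p / p2 = 1 by rewrite -mulrDr pp divff ?gt_eqF.
have := le_trans sum_le (holder_sum (fun=> powR_ge0 _ _) (fun=> powR_ge0 _ _)
   (divr_gt0 p0 p10) (divr_gt0 p0 p20) ab).
set SX := \sum_(i < d) _; set SU := \sum_(i < d) _; set SV := \sum_(i < d) _.
have SX0 : 0 <= SX by apply: sumr_ge0 => i _; exact: powR_ge0.
clearbody SX SU SV; move=> SXle; have pV0 : 0 <= p^-1 by rewrite invr_ge0 ltW.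
have powK (y r : R) : (y `^ (p / r)) `^ p^-1 = y `^ r^-1.
  by rewrite -powRrM mulrAC divff ?mul1r // gt_eqF.
rewrite -(powK SU p1) -(powK SV p2) -powRM ?powR_ge0 //.
by rewrite ge0_ler_powR // nnegrE ?mulr_ge0 ?powR_ge0.
Qed.

(** * Factors attaining the minimum *)

Definition rect_diag (R : nmodType) (a b : nat) (y : nat -> R) : 'M[R]_(a, b) :=
  \matrix_(i, j) (y i *+ (i == j :> nat)).

Lemma tr_rect_diag (R : nmodType) (a b : nat) (y : nat -> R) :
  (rect_diag a b y)^T = rect_diag b a y.
Proof. by apply/matrixP => i j; rewrite !mxE eq_sym; case: eqP => [->|]. Qed.

(** The middle dimension [b] cuts off all indices from [b] on; the hypothesis makes the lost
    products 0, whatever the order of [a], [b] and [c]. *)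
Lemma mul_rect_diag (R : pzSemiRingType) (a b c : nat) (y z : nat -> R) :
  (forall i, (b <= i)%N -> y i * z i = 0) ->
  rect_diag a b y *m rect_diag b c z = rect_diag a c (fun i => y i * z i).
Proof.
move=> yz; apply/matrixP => i j; rewrite !mxE.
case: (ltnP i b) => [ib|bi].
  rewrite (bigD1 (Ordinal ib)) //= big1 ?addr0 => [|k ki].
    by rewrite !mxE /= eqxx mulr1n mulrnAr.
  rewrite !mxE; case: eqP => [ik|_]; last by rewrite mul0r.
  by case/eqP: ki; apply: val_inj.
rewrite yz // mul0rn big1 // => k _; rewrite !mxE.
by rewrite gtn_eqF ?mul0r // (leq_trans (ltn_ord k)).
Qed.

Lemma diag_seqE (R : nmodType) (n : nat) (x : nat -> R) :
  diag_seq n x = rect_diag n n x.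
Proof. by apply/matrixP => i j; rewrite !mxE. Qed.

Lemma schatten_sum_gram_diag (R : realType) (q : R) (m n : nat)
    (X : 'M[R]_(m, n)) (O : 'M[R]_n) (x : nat -> R) : 0 < q ->
  O *m O^T = 1%:M -> X^T *m X = O^T *m diag_seq n x *m O ->
  schatten_sum q X = \sum_(i < n) x i `^ (q / 2).
Proof.
move=> q0 OO EX; apply: (@schatten_sumE _ _ _ _ _ 0 0) => //.
by rewrite EX char_poly_spectral.
Qed.

(** If [x i] were nonzero, the leading block of size [i.+1] would be an invertible compression of
    [X^T X], giving [X] rank at least [i.+1]. *)
Lemma rank_spectrum (R : rcfType) (m n : nat) (X : 'M[R]_(m, n))
    (O : 'M[R]_n) (x : nat -> R) :
  O *m O^T = 1%:M -> X^T *m X = O^T *m diag_seq n x *m O ->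
  {homo x : i j / (i <= j)%N >-> j <= i} ->
  (forall i, 0 <= x i) -> (forall i, (n <= i)%N -> x i = 0) ->
  forall i, (\rank X <= i)%N -> x i = 0.
Proof.
move=> OO EX xh x0 xn i ri; case: (ltnP i n) => [lin|/xn //].
apply/eqP; apply: contraLR ri => xi; rewrite -ltnNge.
have := compress_diag lin x OO; rewrite -EX => ED.
have : \rank (diag_seq i.+1 x) = i.+1.
  apply: mxrank_unit; rewrite unitmxE det_diag unitfE.
  apply/prodf_neq0 => j _; rewrite mxE gt_eqF //.
  by apply: lt_le_trans (xh _ _ (leq_ord j)); rewrite lt_def xi x0.
rewrite -ED mulmxA => <-.
exact: leq_trans (mxrankM_maxl _ _) (mxrankM_maxr _ _).
Qed.

Lemma sum_ord_support (V : nmodType) (a b : nat) (F : nat -> V) :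
  (forall i, (a <= i)%N -> F i = 0) -> (forall i, (b <= i)%N -> F i = 0) ->
  \sum_(i < a) F i = \sum_(i < b) F i.
Proof.
wlog ab : a b / (a <= b)%N.
  move=> W Fa Fb; case/orP: (leq_total a b) => ?; first exact: W.
  by symmetry; exact: W.
move=> Fa _; rewrite (big_ord_widen _ F ab) big_mkcond /=.
by apply: eq_bigr => i _; case: ltnP => // /Fa.
Qed.

(** No left singular vectors are built: the columns of [X *m W^T] are those vectors times [s_i], and
    rescaling by [s_i^(- p / p2)] leaves [s_i^(p / p1)] in [U], while [V] receives
    [s_i^(p / p2)]. *)
Lemma schatten_mul_attained (R : realType) (m n d : nat) (X : 'M[R]_(m, n))
    (p p1 p2 : R) :
  (\rank X <= d)%N -> 0 < p -> 0 < p1 -> 0 < p2 -> p1^-1 + p2^-1 = p^-1 ->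
  exists (U : 'M[R]_(m, d)) (V : 'M[R]_(n, d)),
    X = U *m V^T /\ schatten p X = schatten p1 U * schatten p2 V.
Proof.
move=> rX p0 p10 p20 pp.
have [W [x [WW EX x0 xh xn]]] := gram_spectral X.
have xd i : (d <= i)%N -> x i = 0.
  by move=> di; apply: (rank_spectrum WW EX) => //; exact: leq_trans di.
have WtW := mulmx1C WW.
(* The halves appear because [x i] is [s_i^2]. A negative power of 0 is 0 here, so [g] is a
   pseudo-inverse of [f]. *)
pose t := p / p2; pose f i := x i `^ (t / 2); pose g i := x i `^ (- (t / 2)).
have t0 : 0 < t by exact: divr_gt0.
have f0 i : x i = 0 -> f i = 0.
  by move=> xi; rewrite /f xi powR0 // gt_eqF // divr_gt0.
have g0 i : x i = 0 -> g i = 0.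
  by move=> xi; rewrite /g xi powR0 // oppr_eq0 gt_eqF // divr_gt0.
have gf i : g i * f i = (x i != 0)%:R.
  have [xi|xi] := eqVneq (x i) 0; first by rewrite g0 // mul0r.
  by rewrite -powRD ?addNr ?powRr0 // xi implybT.
pose Y := X *m W^T.
have YY : Y^T *m Y = rect_diag n n x.
  rewrite -diag_seqE trmx_mul trmxK mulmxA -(mulmxA W) EX.
  by rewrite !mulmxA WW mul1mx -mulmxA WW mulmx1.
(* Column [i] of [Y] has squared norm [x i], so multiplying by the indicator [g i * f i] does not
   change [Y]. *)
have Y0 k (i : 'I_n) : x i = 0 -> Y k i = 0.
  move=> xi; have /matrixP/(_ i i) := YY; rewrite [RHS]mxE xi mul0rn mxE.
  move/eqP; rewrite psumr_eq0 => [/allP/(_ k (mem_index_enum k))|l _].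
    by rewrite /= [Y^T _ _]mxE -expr2 sqrf_eq0 => /eqP.
  by rewrite [Y^T _ _]mxE -expr2 sqr_ge0.
pose U := Y *m rect_diag n d g; pose V := W^T *m rect_diag n d f.
(* The entry [g i * x i * g i] is [x i] to the power [1 - p / p2 = p / p1]. The factors [1%:M]
   present the diagonal matrix as a spectral decomposition. *)
have UU : U^T *m U = 1%:M^T *m diag_seq d (fun i => x i `^ (p / p1)) *m 1%:M.
  rewrite trmx_mul tr_rect_diag mulmxA -(mulmxA _ Y^T) YY.
  rewrite mul_rect_diag => [|i ni]; last by rewrite xn ?mulr0.
  rewrite mul_rect_diag => [|i ni]; last by rewrite xn ?mulr0 ?mul0r.
  rewrite trmx1 mul1mx mulmx1; apply/matrixP => i j; rewrite !mxE.
  congr (_ *+ _); have [xi|xi] := eqVneq (x i) 0.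
    by rewrite g0 // mulr0 xi powR0 // gt_eqF // divr_gt0.
  rewrite /g -[X in _ * X * _]powRr1 // -!powRD ?xi ?implybT //.
  congr (_ `^ _); rewrite /t.
  have -> : p / p1 = 1 - p / p2; last by field; rewrite gt_eqF.
  by rewrite -[p1^-1](addrK p2^-1) pp mulrBr divff // gt_eqF.
have VV : V^T *m V = 1%:M^T *m diag_seq d (fun i => x i `^ (p / p2)) *m 1%:M.
  rewrite trmx_mul trmxK tr_rect_diag mulmxA -(mulmxA _ W) WW mulmx1.
  rewrite mul_rect_diag => [|i ni]; last by rewrite f0 ?mul0r ?xn.
  rewrite trmx1 mul1mx mulmx1; apply/matrixP => i j; rewrite !mxE.
  congr (_ *+ _); have [xi|xi] := eqVneq (x i) 0.
    by rewrite f0 // mulr0 xi powR0 // gt_eqF // divr_gt0.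
  by rewrite /f -powRD ?xi ?implybT // -splitr.
exists U, V; split.
  rewrite trmx_mul tr_rect_diag trmxK mulmxA -(mulmxA Y) mul_rect_diag; last first.
    by move=> i di; rewrite g0 ?mul0r // xd.
  suff -> : Y *m rect_diag n n (fun i => g i * f i) = Y.
    by rewrite /Y -mulmxA WtW mulmx1.
  rewrite -diag_seqE; apply/matrixP => k i; rewrite mul_mx_diag mxE [X in _ * X]mxE gf.
  by have [/Y0 ->|_] := eqVneq (x i) 0; rewrite ?mul0r ?mulr1.
have I1 : 1%:M *m 1%:M^T = 1%:M :> 'M[R]_d by rewrite trmx1 mulmx1.
rewrite /schatten (schatten_sum_gram_diag p0 WW EX).
rewrite (schatten_sum_gram_diag (x := fun i => x i `^ (p / p1)) p10 I1 UU).
rewrite (schatten_sum_gram_diag (x := fun i => x i `^ (p / p2)) p20 I1 VV).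
(* All three Schatten sums equal one number [S], as [x] vanishes beyond both [n] and [d]; what
   remains is to split [S] to the power [p^-1]. *)
have powE (r : R) : 0 < r ->
    \sum_(i < d) (x i `^ (p / r)) `^ (r / 2) = \sum_(i < n) x i `^ (p / 2).
  move=> r0; have xp0 i : x i = 0 -> x i `^ (p / 2) = 0.
    by move=> ->; rewrite powR0 // gt_eqF // divr_gt0.
  rewrite (@sum_ord_support _ n d (fun i => x i `^ (p / 2))); last 2 first.
  - by move=> i /xn/xp0.
  - by move=> i /xd/xp0.
  by apply: eq_bigr => i _; rewrite -powRrM mulrA divfK // gt_eqF.
have powD (S : R) : S `^ p^-1 = S `^ p1^-1 * S `^ p2^-1.
  by rewrite -powRD ?pp // invr_eq0 gt_eqF.
by rewrite powD; congr (_ `^ _ * _ `^ _); symmetry; exact: powE.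
Qed.

Theorem theorem1 (R : realType) (m n d : nat) (X : 'M[R]_(m, n))
  (p p1 p2 : R) :
  (\rank X <= d)%N ->
  0 < p -> p <= 1 -> 0 < p1 -> 0 < p2 ->
  p1^-1 + p2^-1 = p^-1 ->
  (exists (U : 'M[R]_(m, d)) (V : 'M[R]_(n, d)),
      X = U *m V^T /\ schatten p X = schatten p1 U * schatten p2 V) /\
  (forall (U : 'M[R]_(m, d)) (V : 'M[R]_(n, d)),
      X = U *m V^T -> schatten p X <= schatten p1 U * schatten p2 V).
Proof.
move=> rX p0 _ p10 p20 pp; split; first exact: schatten_mul_attained.
by move=> U V ->; exact: schatten_mul_le.
Qed.
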